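(* Let $\nu_1,\nu_2\ge 0$ and let $\mathcal{L}_n^{(\nu_1,\nu_2)}$ ($n\ge1$) be the Stancu type operators including generalized Brenke polynomials associated with $A_1,A_2,h$ as in the context. Let $f\in\tilde{C}[0,\infty)\cap E$, i.e. $f:[0,\infty)\to\mathbb{R}$ is uniformly continuous and $f(x)/(1+x^2)$ converges as $x\to\infty$. Then for every $n\ge1$ and $x\in[0,\infty)$, $$\left|\mathcal{L}_n^{(\nu_1,\nu_2)}(f;x)-f(x)\right|\le 2\,\omega\left(f;\delta_n(x)\right),$$ where $\delta_n(x):=\sqrt{\mathcal{L}_n^{(\nu_1,\nu_2)}\left((s-x)^2;x\right)}$ and $\omega(f;\cdot)$ is the modulus of continuity of $f$.
   Context: Setting. Let $R>1$. Let $A_1,A_2:\mathbb{R}\to(0,\infty)$ and $h$ be functions, analytic on $\{t:|t|<R\}$ with (real) power series expansions convergent for $|t|<R$: $A_1(t)=\sum_{k\ge0}a_{1,k}t^k$ with $a_{1,0}\neq0$; $A_2(t)=\sum_{k\ge0}a_{2,k}t^k$ with $a_{2,k}\ne0$ for all $k$; $h(t)=\sum_{k\ge1}h_kt^k$ with $h_1\neq0$. The generalized Brenke polynomials $\pi_k$ ($k\ge 0$) are the polynomials with $$A_1(h(t))\,A_2(xh(t))=\sum_{k=0}^\infty \pi_k(x)t^k ,$$ where the series converges and the identity holds for real $t$ with $|t|<R$ and every $x\in[0,\infty)$. It is assumed that $h'(1)=1$ and $\pi_k(x)\ge0$ for all $k\ge0$ and $x\in[0,\infty)$. Operators. For $\nu_1,\nu_2\ge0$,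 $n\ge1$, $x\in[0,\infty)$ and $f:[0,\infty)\to\mathbb{R}$ (for which the series converges), $$\mathcal{L}_n^{(\nu_1,\nu_2)}(f;x)=\frac{1}{A_1(h(1))A_2(nxh(1))}\sum_{k=0}^\infty\pi_k(nx)\,f\!\left(\frac{k+\nu_1}{n+\nu_2}\right).$$ In $\mathcal{L}_n^{(\nu_1,\nu_2)}((s-x)^2;x)$ the operator acts on the function $s\mapsto(s-x)^2$, with $x$ fixed. The modulus of continuity is $\omega(f;\delta)=\sup\{|f(s)-f(t)|: s,t\in[0,\infty),\ |s-t|\le\delta\}$ for $\delta\ge0$. *)

(* Defs.v *)
From mathcomp Require Import all_boot all_order all_algebra.
From mathcomp Require Import all_classical all_reals all_analysis.
Import Order.TTheory GRing.Theory Num.Theory.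
Import numFieldNormedType.Exports.

Set Implicit Arguments.
Unset Strict Implicit.
Unset Printing Implicit Defensive.

Local Open Scope classical_set_scope.
Local Open Scope ring_scope.

Definition has_power_series (R : realType) (r : R) (F : R -> R) (a : nat -> R)
    : Prop :=
  forall t : R, `|t| < r -> pseries a t @ \oo --> F t.

Definition brenke_generating (R : realType) (r : R) (A1 A2 h : R -> R)
    (p : nat -> {poly R}) : Prop :=
  forall t x : R, `|t| < r -> 0 <= x ->
    pseries (fun k => (p k).[x]) t @ \oo --> A1 (h t) * A2 (x * h t).

(* A function on [0, +oo[ is represented by a total function on R, of which
   only the values on [0, +oo[ are used, here and below. *)
Definition stancu_brenke (R : realType) (A1 A2 h : R -> R)
    (p : nat -> {poly R}) (nu1 nu2 : R) (n : nat) (f : R -> R) (x : R) : R :=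
  (A1 (h 1) * A2 (n%:R * x * h 1))^-1 *
  limn (series (fun k => (p k).[n%:R * x] * f ((k%:R + nu1) / (n%:R + nu2)))).

Definition unif_continuous_ge0 (R : realType) (f : R -> R) : Prop :=
  forall e : R, 0 < e -> exists2 d : R, 0 < d &
    forall s t : R, 0 <= s -> 0 <= t -> `|s - t| < d -> `|f s - f t| < e.

Definition in_E (R : realType) (f : R -> R) : Prop :=
  cvg (f x / (1 + x ^+ 2) @[x --> +oo]).

(* The real-valued sup is junk on unbounded sets; for f uniformly continuous
   on [0, +oo[ the set below is bounded for every delta. *)
Definition modulus_continuity (R : realType) (f : R -> R) (delta : R) : R :=
  sup [set d | exists s t : R,
    [/\ 0 <= s, 0 <= t, `|s - t| <= delta & d = `|f s - f t|]].

(* Main.v *)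
(* The operator is a mean: at t = 1 the generating identity says that the
   nonnegative weights pi_k(n x) sum to W = A1(h(1)) A2(n x h(1)). Cutting the
   segment from x to s into 1 + floor(|s - x| / delta) steps gives
   |f(s) - f(x)| <= (1 + (s - x)^2 / delta^2) omega(f; delta), and averaging
   with delta^2 equal to the mean of (s - x)^2 yields the factor 2. If that
   delta is 0, every term of positive weight sits at x. The second moment is
   finite because the generating series still converges at some t > 1. *)
Require Import Defs.
From mathcomp Require Import all_boot all_order all_algebra.
From mathcomp Require Import all_classical all_reals all_analysis.
From mathcomp Require Import ring lra.
Import Order.TTheory GRing.Theory Num.Theory.
Import numFieldNormedType.Exports.

Set Implicit Arguments.
Unset Strict Implicit.
Unset Printing Implicit Defensive.

Local Open Scope classical_set_scope.
Local Open Scope ring_scope.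

Lemma cvg_series_lin (R : realType) (u v : nat -> R) (a b U V : R) :
  series u @ \oo --> U -> series v @ \oo --> V ->
  series (fun k => a * u k + b * v k) @ \oo --> a * U + b * V.
Proof.
move=> cu cv.
have -> : series (fun k => a * u k + b * v k) =
    (fun m => a * series u m + b * series v m).
  by apply/funext => m; rewrite /series /= big_split /= !mulr_sumr.
by apply: cvgD; apply: cvgMr.
Qed.

Lemma dominated_series (R : realType) (g b : nat -> R) (B : R) :
  (forall k, `|g k| <= b k) -> series b @ \oo --> B ->
  cvgn (series g) /\ `|limn (series g)| <= B.
Proof.
move=> gb bB.
have cb : cvgn (series b) by apply/cvg_ex; exists B.
have cng : cvgn [normed series g].
  apply: (series_le_cvg _ _ gb cb) => // k.
  exact: le_trans (gb k).
split; first exact: normed_cvg.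
apply: le_trans (lim_series_norm cng) _.
by rewrite -(cvg_lim _ bB)//; apply: lim_series_le.
Qed.

(** Induction on the number of steps, splitting off one step of length at most [d] and applying the
    triangle inequality. *)
Lemma increment_le_chain (R : realType) (f : R -> R) (d B : R) :
  (forall s t, 0 <= s -> 0 <= t -> `|s - t| <= d -> `|f s - f t| <= B) ->
  forall (m : nat) (s t : R), 0 <= s -> 0 <= t -> `|s - t| <= m%:R * d ->
    `|f s - f t| <= m%:R * B.
Proof.
move=> fB; elim=> [|m IH] s t s0 t0.
  rewrite !mul0r normr_le0 subr_eq0 => /eqP ->.
  by rewrite subrr normr0.
move=> st.
have m1 : 0 < m.+1%:R :> R by rewrite ltr0n.
(* The first of [m + 1] equal steps from [s] to [t] ends at [u]; as a convex combination, [u] stays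
   in the half-line. *)
pose u := (m%:R * s + t) / m.+1%:R.
have u0 : 0 <= u by rewrite divr_ge0 ?addr_ge0 ?mulr_ge0 ?ler0n.
have su : s - u = (s - t) / m.+1%:R.
  by rewrite /u; field; rewrite -natr1 in m1; lra.
have ut : u - t = m%:R * ((s - t) / m.+1%:R).
  by rewrite /u; field; rewrite -natr1 in m1; lra.
have std : `|(s - t) / m.+1%:R| <= d.
  by rewrite normrM normfV (gtr0_norm m1) ler_pdivrMr// mulrC.
have -> : f s - f t = (f s - f u) + (f u - f t) by ring.
apply: le_trans (ler_normD _ _) _.
rewrite -natr1 mulrDl mul1r addrC lerD//.
  by apply: IH => //; rewrite ut normrM ger0_norm ?ler0n// ler_wpM2l.
by apply: fB => //; rewrite su.
Qed.

(** The supremum is an upper bound only once the set of increments is known to be bounded; uniform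
    continuity at tolerance 1, chained along the segment, gives this. *)
Lemma increment_le_modulus (R : realType) (f : R -> R) (d : R) :
  unif_continuous_ge0 f -> forall s t, 0 <= s -> 0 <= t -> `|s - t| <= d ->
    `|f s - f t| <= modulus_continuity f d.
Proof.
move=> fu s t s0 t0 st.
apply: ub_le_sup; last by exists s, t.
have [e e0 fe] := fu 1 ltr01.
(* Steps of length [e / 2] satisfy the strict inequality [< e] required by [fe]; the integer factor
   is enough of them to cover length [d]. *)
exists ((Num.truncn (d / (e / 2))).+1%:R * 1) => _ [s' [t' [s'0 t'0 st' ->]]].
apply: (@increment_le_chain _ f (e / 2)) => //.
  by move=> a b a0 b0 ab; apply/ltW/fe => //; lra.
apply: le_trans st' _; rewrite -ler_pdivrMr; last lra.
exact/ltW/truncnS_gt.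
Qed.

Lemma modulus_continuity_ge0 (R : realType) (f : R -> R) (d : R) :
  unif_continuous_ge0 f -> 0 <= d -> 0 <= modulus_continuity f d.
Proof.
move=> fu d0; have := @increment_le_modulus _ f d fu 0 0 (lexx _) (lexx _).
by rewrite !subrr normr0; apply.
Qed.

Lemma increment_le_modulus_sqr (R : realType) (f : R -> R) (d s t : R) :
  unif_continuous_ge0 f -> 0 < d -> 0 <= s -> 0 <= t ->
  `|f s - f t| <=
    modulus_continuity f d + modulus_continuity f d / d ^+ 2 * (s - t) ^+ 2.
Proof.
move=> fu d0 s0 t0; set w := modulus_continuity f d.
have w0 : 0 <= w by apply: modulus_continuity_ge0 (ltW d0).
pose y := `|s - t| / d; pose m := Num.truncn y.
have y0 : 0 <= y by rewrite divr_ge0// ltW.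
have my : m%:R <= y by rewrite truncn_le.
have stm : `|s - t| <= m.+1%:R * d.
  by rewrite -ler_pdivrMr//; apply/ltW/truncnS_gt.
apply: le_trans
  (increment_le_chain (@increment_le_modulus _ _ _ fu) s0 t0 stm) _.
have -> : w + w / d ^+ 2 * (s - t) ^+ 2 = (y ^+ 2 + 1) * w.
  by rewrite /y expr_div_n real_normK ?num_real//; field; lra.
rewrite ler_wpM2r// -natr1 lerD2r.
(* A natural number is at most its square, so [m <= m ^+ 2 <= y ^+ 2] even when [y < 1]. *)
apply: (@le_trans _ _ (m%:R ^+ 2)); last by rewrite lerXn2r ?nnegrE.
by rewrite -natrX ler_nat; case: (m) => // k; rewrite expnS expn1 leq_pmulr.
Qed.

Lemma weighted_mean_le_modulus (R : realType) (w s : nat -> R) (W x : R)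
    (f : R -> R) :
  (forall k, 0 <= w k) -> (forall k, 0 <= s k) -> 0 < W -> 0 <= x ->
  series w @ \oo --> W -> cvgn (series (fun k => w k * (s k - x) ^+ 2)) ->
  unif_continuous_ge0 f ->
  `|W^-1 * limn (series (fun k => w k * f (s k))) - f x| <=
    2 * modulus_continuity f
      (Num.sqrt (W^-1 * limn (series (fun k => w k * (s k - x) ^+ 2)))).
Proof.
move=> w0 s0 W0 x0 cw cv fu.
set v := fun k => w k * (s k - x) ^+ 2; set V := limn (series v).
have v0 k : 0 <= v k by rewrite mulr_ge0// sqr_ge0.
have vV k : v k <= V.
  have nd : {homo series v : m n / (m <= n)%N >-> m <= n}.
    by apply: nondecreasing_series.
  (* Partial sums exclude their upper index, so [k.+1] is the first one containing [v k]. *)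
  apply: le_trans (nondecreasing_cvgn_le nd cv k.+1).
  by rewrite /series/= big_nat_recr//= lerDr sumr_ge0.
have V0 : 0 <= V := le_trans (v0 0%N) (vV 0%N).
set d := Num.sqrt _; set om := modulus_continuity f d.
have d2 : d ^+ 2 = W^-1 * V by rewrite sqr_sqrtr// mulr_ge0// invr_ge0 ltW.
have om0 : 0 <= om by apply: modulus_continuity_ge0 (sqrtr_ge0 _).
have gb k : `|w k * (f (s k) - f x)| <= om * w k + om / d ^+ 2 * v k.
  rewrite normrM (ger0_norm (w0 k)).
  have := sqrtr_ge0 (W^-1 * V); rewrite -/d le_eqVlt => /orP[/eqP dE|d0].
    (* Degenerate case [d = 0]: division by zero gives 0, so the bound reduces to [om * w k]. Since
       [v k = 0], either [w k = 0] or [s k = x], and the left side vanishes. *)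
    have VE : V = 0.
      move: d2; rewrite -dE expr0n/= => /esym/eqP.
      by rewrite mulf_eq0 invr_eq0 gt_eqF//= => /eqP.
    have : v k == 0 by rewrite eq_le v0 andbT -VE.
    rewrite -dE expr0n/= invr0 mulr0 mul0r addr0 /v mulf_eq0 sqrf_eq0 subr_eq0.
    case/orP => /eqP ->; first by rewrite mul0r mulr0.
    by rewrite subrr normr0 mulr0 mulr_ge0.
  have -> : om * w k + om / d ^+ 2 * v k =
      w k * (om + om / d ^+ 2 * (s k - x) ^+ 2) by rewrite /v; ring.
  by rewrite ler_wpM2l//; apply: increment_le_modulus_sqr.
have [cg gB] := dominated_series gb (cvg_series_lin cw cv).
(* Centring at [f x] gives both the convergence of this series and its limit [G + f x * W]. *)
have -> : series (fun k => w k * f (s k)) =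
    series (fun k => 1 * (w k * (f (s k) - f x)) + f x * w k).
  by congr series; apply/funext => k; ring.
rewrite (cvg_lim _ (cvg_series_lin cg cw))// mul1r.
set G := limn _ in gB *.
have -> : W^-1 * (G + f x * W) - f x = W^-1 * G by field; lra.
rewrite normrM gtr0_norm ?invr_gt0// mulrC ler_pdivrMr//.
apply: le_trans gB _.
rewrite -/V; have -> : V = d ^+ 2 * W by rewrite d2; field; lra.
(* Equality holds for [d != 0]; for [d = 0] the left side is 0. *)
have : om / d ^+ 2 * (d ^+ 2 * W) <= om * W; last lra.
have [->|d0] := eqVneq d 0.
  by rewrite expr0n/= mul0r mulr0 mulr_ge0// ltW.
by rewrite mulrA divfK// sqrf_eq0.
Qed.

Lemma cvg_series_sqr_growth (R : realType) (w s : nat -> R) (r M : R) :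
  1 < r -> (forall k, 0 <= w k) ->
  (forall t, `|t| < r -> cvgn (pseries w t)) ->
  (forall k, `|s k| <= M * k.+1%:R) ->
  cvgn (series (fun k => w k * s k ^+ 2)).
Proof.
move=> r1 w0 cw sM.
have M0 : 0 <= M by have := sM 0%N; rewrite mulr1; apply: le_trans.
(* Bernoulli: [e * (k + 1) <= (1 + e) ^+ k], so squares of linear terms are
   dominated by powers of [t := (1 + e) ^+ 2], and [t < r]. *)
pose e := Num.min 1 ((r - 1) / 4).
have [e0 e1 er] : [/\ 0 < e, e <= 1 & e <= (r - 1) / 4].
  by rewrite lt_min !ge_min !lexx orbT ltr01/=; split => //; lra.
pose t := (1 + e) ^+ 2.
(* From [e <= 1], [t <= 1 + 3 * e], and [e <= (r - 1) / 4] keeps this below [r]. *)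
have tr : `|t| < r by rewrite ger0_norm ?sqr_ge0// /t; nra.
have bern (k : nat) : e * k.+1%:R <= (1 + e) ^+ k.
  elim: k => [|k IH]; first by rewrite mulr1 expr0.
  rewrite -natr1 mulrDr exprS.
  have : 1 <= (1 + e) ^+ k by rewrite exprn_ege1//; lra.
  nra.
have := @is_cvg_seriesZ _ _ ((M / e) ^+ 2) (cw _ tr).
apply: series_le_cvg => k.
- by rewrite mulr_ge0// sqr_ge0.
- by rewrite mulr_ge0 ?sqr_ge0//= mulr_ge0// exprn_ge0// sqr_ge0.
have sk : s k ^+ 2 <= (M / e) ^+ 2 * t ^+ k.
  rewrite -[s k ^+ 2]real_normK ?num_real// /t -exprM mulnC exprM -exprMn.
  have e'0 : 0 <= 1 + e by lra.
  rewrite lerXn2r ?nnegrE ?mulr_ge0 ?invr_ge0 ?exprn_ge0 ?(ltW e0)//.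
  apply: le_trans (sM k) _; rewrite -mulrA ler_wpM2l// mulrC ler_pdivlMr//.
  by rewrite mulrC.
apply: le_trans (ler_wpM2l (w0 k) sk) _.
by rewrite mulrCA.
Qed.

Theorem theorem2p2 (R : realType) (r : R) (r_gt1 : 1 < r)
    (A1 A2 h : R -> R) (a1 a2 c : nat -> R) (p : nat -> {poly R})
    (A1_gt0 : forall t : R, 0 < A1 t) (A2_gt0 : forall t : R, 0 < A2 t)
    (A1_series : has_power_series r A1 a1) (a1_0 : a1 0%N != 0)
    (A2_series : has_power_series r A2 a2) (a2_neq0 : forall k : nat, a2 k != 0)
    (h_series : has_power_series r h c) (c_0 : c 0%N = 0) (c_1 : c 1%N != 0)
    (p_gen : brenke_generating r A1 A2 h p)
    (dh1 : derive1 h 1 = 1)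
    (p_ge0 : forall (k : nat) (x : R), 0 <= x -> 0 <= (p k).[x])
    (nu1 nu2 : R) (nu1_ge0 : 0 <= nu1) (nu2_ge0 : 0 <= nu2)
    (f : R -> R) (f_unif : unif_continuous_ge0 f) (f_E : in_E f)
    (n : nat) (n_ge1 : (1 <= n)%N) (x : R) (x_ge0 : 0 <= x) :
  `|stancu_brenke A1 A2 h p nu1 nu2 n f x - f x| <=
    2 * modulus_continuity f
      (Num.sqrt (stancu_brenke A1 A2 h p nu1 nu2 n (fun s => (s - x) ^+ 2) x)).
Proof.
set W := A1 (h 1) * A2 (n%:R * x * h 1).
have nx0 : 0 <= n%:R * x by rewrite mulr_ge0.
have w0 k : 0 <= (p k).[n%:R * x] by exact: p_ge0.
have n1 : 1 <= n%:R :> R by rewrite ler1n.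
have s0 (k : nat) : 0 <= (k%:R + nu1) / (n%:R + nu2).
  by rewrite divr_ge0// addr_ge0.
have cw : series (fun k => (p k).[n%:R * x]) @ \oo --> W.
  have := p_gen 1 (n%:R * x); rewrite normr1 => /(_ r_gt1 nx0).
  by rewrite /pseries; under [fun _ => _ * _]eq_fun do rewrite expr1n mulr1.
apply: weighted_mean_le_modulus => //; first by rewrite mulr_gt0.
(* As [n + nu2 >= 1], each node is at most [k + nu1], so its distance to [x] is at most
   [k + nu1 + x <= (1 + nu1 + x) * (k + 1)]. *)
apply: (@cvg_series_sqr_growth _ _ _ r (1 + nu1 + x)) => //.
  by move=> t tr; apply/cvg_ex; eexists; exact: p_gen tr nx0.
move=> k; have k0 : 0 <= k%:R :> R by [].
have sk : (k%:R + nu1) / (n%:R + nu2) <= k%:R + nu1.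
  by rewrite ler_pdivrMr; nra.
have := s0 k; rewrite -natr1 ler_norml => sk0.
by apply/andP; split; nra.
Qed.
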